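(* Let $(\lambda_n)_{n\in\mathbb{Z}}$ be a sequence of real numbers with $\lambda_n>1$ for all $n$, let $N\ge 1$ be an integer and let $0<p<1$. Let $MD_p:\mathbb{R}^2\to\mathbb{R}$ be the discrete Lagrangian descriptor, as a function of the initial condition $(x_0,y_0)$ at time $n=0$, of the linear area-preserving nonautonomous map $x_{n+1}=\lambda_n x_n$, $y_{n+1}=\frac{1}{\lambda_n}y_n$ (defined in the context). Then: (1) For every straight line $L\subset\mathbb{R}^2$ transverse to the stable manifold $\{x=0\}$ of the hyperbolic trajectory at the origin, the restriction of $MD_p$ to $L$ is not differentiable at the point where $L$ intersects $\{x=0\}$. (2) For every straight line $L\subset\mathbb{R}^2$ transverse to the unstable manifold $\{y=0\}$ of the hyperbolic trajectory at the origin, the restriction of $MD_p$ to $L$ is not differentiable at the point where $L$ intersects $\{y=0\}$.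
   Context: For an initial condition $(x_0,y_0)\in\mathbb{R}^2$ at time $n=0$, let $\{(x_n,y_n)\}_{n=-N}^{N}$ be the orbit segment determined by $x_{n+1}=\lambda_n x_n$, $y_{n+1}=\lambda_n^{-1}y_n$ for $-N\le n\le N-1$ (each step is invertible, so the backward iterates are uniquely determined). For $p\le 1$ the discrete Lagrangian descriptor is $$MD_p(x_0,y_0)=\sum_{i=-N}^{N-1}\left(|x_{i+1}-x_i|^p+|y_{i+1}-y_i|^p\right).$$ The trajectory $x=y=0$ is regarded as a hyperbolic trajectory, with stable manifold $\{x=0\}$ and unstable manifold $\{y=0\}$ for all $n$. A line is transverse to $\{x=0\}$ (respectively $\{y=0\}$) if it is not parallel or equal to it. *)

(* Defs.v *)
From HB Require Import structures.
From mathcomp Require Import all_boot all_order all_algebra.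
From mathcomp Require Import all_classical all_reals all_analysis.
Import Order.TTheory GRing.Theory Num.Theory.
Import numFieldNormedType.Exports.

Set Implicit Arguments.
Unset Strict Implicit.
Unset Printing Implicit Defensive.

Local Open Scope classical_set_scope.
Local Open Scope ring_scope.

Section Dynamics.
Variable R : realType.
Implicit Types (lam : int -> R) (z : R * R).

Definition step lam (n : int) z : R * R := (lam n * z.1, (lam n)^-1 * z.2).

Definition step_inv lam (n : int) z : R * R := ((lam n)^-1 * z.1, lam n * z.2).

Fixpoint forward_orbit lam z (n : nat) : R * R :=
  if n is k.+1 then step lam k%:Z (forward_orbit lam z k) else z.

(* [backward_orbit lam z k] is the point of the orbit at time [- k]. *)
Fixpoint backward_orbit lam z (n : nat) : R * R :=
  if n is k.+1 then step_inv lam (- k.+1%:Z) (backward_orbit lam z k) else z.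

(* The point at time [n] of the orbit that is at [z] at time 0; [orbit0],
   [orbitS] and [orbit_unique] below characterize it. *)
Definition orbit lam z (n : int) : R * R :=
  match n with
  | Posz k => forward_orbit lam z k
  | Negz k => backward_orbit lam z k.+1
  end.

Lemma step_invK lam n z : lam n != 0 -> step lam n (step_inv lam n z) = z.
Proof.
by case: z => x y h; rewrite /step /step_inv /= mulrA mulfV // mul1r mulrA mulVf // mul1r.
Qed.

Lemma stepK lam n z : lam n != 0 -> step_inv lam n (step lam n z) = z.
Proof.
by case: z => x y h; rewrite /step /step_inv /= mulrA mulVf // mul1r mulrA mulfV // mul1r.
Qed.

Lemma orbit0 lam z : orbit lam z 0 = z.
Proof. by []. Qed.

Lemma orbitS lam z n : (forall m, lam m != 0) ->
  orbit lam z (n + 1) = step lam n (orbit lam z n).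
Proof.
move=> lam0; case: n => [k|k]; first by rewrite -PoszD addn1.
have -> : Negz k + 1 = - k%:Z by rewrite NegzE -addn1 PoszD opprD addrNK.
rewrite [in RHS]/orbit [in RHS]/= -NegzE step_invK //.
by case: k => // k; rewrite -NegzE.
Qed.

Lemma orbit_unique lam z (u : int -> R * R) : (forall m, lam m != 0) ->
  u 0 = z -> (forall n, u (n + 1) = step lam n (u n)) -> u =1 orbit lam z.
Proof.
move=> lam0 u0 uS; case=> [|].
  by elim=> [//|k IH]; rewrite -addn1 PoszD uS IH orbitS.
have back v n : (forall n, v (n + 1) = step lam n (v n)) ->
    v n = step_inv lam n (v (n + 1)) by move=> vS; rewrite vS stepK.
have NS k : Negz k + 1 = - k%:Z by rewrite NegzE -addn1 PoszD opprD addrNK.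
elim=> [|k IH]; rewrite (back u) // (back (orbit lam z)) ?NS ?oppr0 ?u0 //;
  try (by move=> n; apply: orbitS).
by rewrite -NegzE IH.
Qed.

(* The discrete Lagrangian descriptor; [k] ranging over [0, 2N[ encodes the
   time [i = k - N] ranging over [-N, N - 1]. *)
Definition MD lam (N : nat) (p : R) z : R :=
  \sum_(k < N.*2)
    let i := k%:Z - N%:Z in
    (`|(orbit lam z (i + 1)).1 - (orbit lam z i).1| `^ p +
     `|(orbit lam z (i + 1)).2 - (orbit lam z i).2| `^ p).

End Dynamics.

Section PlaneGeometry.
Variable R : realType.
Implicit Types (a v P : R * R) (L M : set (R * R)) (f : R * R -> R).

Definition stable_manifold : set (R * R) := [set z | z.1 = 0].

Definition unstable_manifold : set (R * R) := [set z | z.2 = 0].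

Definition line a v : set (R * R) := [set a + t *: v | t in [set: R]].

Definition is_line L := exists a v, v != 0 /\ L = line a v.

Definition parallel_or_equal L M :=
  exists a b v, [/\ v != 0, L = line a v & M = line b v].

Definition transverse L M := ~ parallel_or_equal L M.

(* Differentiability at [P] of the restriction of [f] to the line [L], read in
   an affine parametrization of [L]. All these parametrizations differ by an
   affine change of parameter, so the choice is immaterial
   ([differentiable_on_lineE]). *)
Definition differentiable_on_line f L P :=
  exists a v (t0 : R), [/\ v != 0, L = line a v, a + t0 *: v = P
    & derivable (fun t : R => f (a + t *: v)) t0 1].

Lemma differentiable_on_lineE f a v (t0 : R) : v != 0 ->
  differentiable_on_line f (line a v) (a + t0 *: v) <->
  derivable (fun t : R => f (a + t *: v)) t0 1.
Proof.
move=> v0; split; last by move=> d; exists a, v, t0.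
move=> [b [w [s0 [w0 eL eP d]]]].
have /= [t' _ ht'] : line b w (a + (t0 + 1) *: v) by rewrite -eL; exists (t0 + 1).
have vE : v = (t' - s0) *: w.
  apply: (addrI (a + t0 *: v)).
  have -> : a + t0 *: v + v = b + t' *: w.
    by rewrite ht' scalerDl scale1r addrA.
  by rewrite -eP -addrA -scalerDl [s0 + _]addrC subrK.
set c := t' - s0 in vE.
have -> : (fun t : R => f (a + t *: v)) =
          (fun s : R => f (b + s *: w)) \o (fun t : R => s0 + c * (t - t0)).
  apply/funext => u /=; congr f.
  rewrite scalerDl (addrA b) eP -(addrA a); congr (_ + _).
  by rewrite mulrC -scalerA -vE -scalerDl [t0 + _]addrC subrK.
apply/derivable1_diffP; apply: differentiable_comp.
  by apply/derivable1_diffP.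
by rewrite subrr mulr0 addr0; apply/derivable1_diffP.
Qed.

End PlaneGeometry.

Arguments stable_manifold {R}.
Arguments unstable_manifold {R}.

(* Main.v *)
Require Import Defs.
From HB Require Import structures.
From mathcomp Require Import all_boot all_order all_algebra.
From mathcomp Require Import all_classical all_reals all_analysis.
From mathcomp Require Import ring lra.
Import Order.TTheory GRing.Theory Num.Theory.
Import numFieldNormedType.Exports.

Local Open Scope classical_set_scope.
Local Open Scope ring_scope.

(** Along an orbit, [x_i = c_i x_0] and [y_i = y_0 / c_i] with [c_i > 0], so
    [MD_p (x, y) = A |x|^p + B |y|^p] with [A, B > 0].  On a line crossing
    [{x = 0}] at parameter [t0], move away from [t0] in a direction in which
    [|y|] does not decrease: the increment of [MD_p] is then at least
    [C h^p] with [C > 0], and since [p < 1] the difference quotients are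
    unbounded. *)

(** A limit [l] of the difference quotients would bound them by [M = |l| + 1] near 0. Together with
    the growth hypothesis this gives [C < M * h ^ (1 - p)] for small [h > 0], which fails as [h]
    tends to 0. Growth on one side of [t0], selected by the sign [s], is enough. *)
Lemma not_derivable_of_power_growth (R : realType) (f : R -> R) (t0 s C p : R) :
  `|s| = 1 -> 0 < C -> p < 1 ->
  (forall h, 0 < h -> C * h `^ p <= f (t0 + s * h) - f t0) ->
  ~ derivable f t0 1.
Proof.
move=> s1 C0 p1 grow /cvg_ex[l /= fl].
pose M := `|l| + 1.
have M0 : 0 < M by rewrite ltr_wpDl.
have /cvgr_norm_lt/(_ M) := fl; rewrite ltrDl ltr01 => /(_ isT).
case=> d /= d0 bnd.
have q0 : 0 < 1 - p by rewrite subr_gt0.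
(* [k] solves [M * k ^ (1 - p) = C / 2], so any [h <= k] gives the contradiction. *)
pose k := (C / (2 * M)) `^ (1 - p)^-1.
have k0 : 0 < k by rewrite powR_gt0 // divr_gt0 // mulr_gt0.
pose h := Num.min (d / 2) k.
have h0 : 0 < h by rewrite lt_min k0 divr_gt0.
have hd : h < d by rewrite gt_min; apply/orP; left; lra.
have sh : `|s * h| = h by rewrite normrM s1 mul1r gtr0_norm.
have sh0 : s * h != 0 by rewrite -normr_eq0 sh gt_eqF.
have := bnd (s * h).
rewrite /ball_ /= sub0r normrN sh => /(_ hd sh0).
rewrite /GRing.scale /= mulr1 normrM normfV sh [s * h + t0]addrC => hM.
have : C * h `^ p < M * h.
  apply: le_lt_trans (grow h h0) _; apply: le_lt_trans (ler_norm _) _.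
  by rewrite -ltr_pdivrMr // mulrC.
have -> : M * h = M * h `^ (1 - p) * h `^ p.
  by rewrite -mulrA -powRD ?subrK ?powRr1 ?(ltW h0) // (gt_eqF h0) implybT.
rewrite ltr_pM2r ?powR_gt0 //; apply/negP; rewrite -leNgt.
have hk : h `^ (1 - p) <= C / (2 * M).
  have -> : C / (2 * M) = k `^ (1 - p).
    rewrite -powRrM mulVf ?gt_eqF // powRr1 // ltW // divr_gt0 // mulr_gt0 //.
  by apply: ge0_ler_powR; rewrite ?nnegrE ?(ltW q0) ?(ltW h0) ?(ltW k0) // ge_min lexx orbT.
apply: le_trans (_ : M * (C / (2 * M)) <= _); first by rewrite ler_pM2l.
have -> : M * (C / (2 * M)) = C / 2 by field; rewrite gt_eqF.
lra.
Qed.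

(** The factor [c] is a product of the multipliers, or of their inverses at negative times; it is
    the same for all initial conditions. *)
Lemma orbit_diagonal (R : realType) (lam : int -> R) (i : int) :
  (forall n, 0 < lam n) ->
  exists2 c : R, 0 < c & forall z, Defs.orbit lam z i = (c * z.1, c^-1 * z.2).
Proof.
move=> lam0.
have fwd n : exists2 c : R, 0 < c &
    forall z, forward_orbit lam z n = (c * z.1, c^-1 * z.2).
  elim: n => [|n [c c0 IH]]; first by exists 1 => // -[x y]; rewrite invr1 !mul1r.
  exists (lam n%:Z * c) => [|z]; first by rewrite mulr_gt0.
  by rewrite /= IH /step /= invfM !mulrA.
have bwd n : exists2 c : R, 0 < c &
    forall z, backward_orbit lam z n = (c * z.1, c^-1 * z.2).
  elim: n => [|n [c c0 IH]]; first by exists 1 => // -[x y]; rewrite invr1 !mul1r.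
  exists ((lam (- n.+1%:Z))^-1 * c) => [|z]; first by rewrite mulr_gt0 ?invr_gt0.
  by rewrite [LHS]/= IH /step_inv /= invfM invrK !mulrA.
by case: i => n; [exact: fwd | exact: (bwd n.+1)].
Qed.

Definition weighted_powers {R : realType} (p : R) (f : R * R -> R) :=
  exists A B : R, [/\ 0 < A, 0 < B &
    forall z, f z = A * `|z.1| `^ p + B * `|z.2| `^ p].

(** The weights add up. The sum has [n.+1] terms because an empty one would have zero weights. *)
Lemma weighted_powers_sum (R : realType) (p : R) n (F : nat -> R * R -> R) :
  (forall k, weighted_powers p (F k)) ->
  weighted_powers p (fun z => \sum_(k < n.+1) F k z).
Proof.
move=> hF; elim: n => [|n [A [B [A0 B0 IH]]]].
  have [A [B [A0 B0 E]]] := hF 0%N.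
  by exists A, B; split => // z; rewrite big_ord_recl big_ord0 addr0.
have [A' [B' [A0' B0' E]]] := hF n.+1.
exists (A + A'), (B + B'); split; rewrite ?addr_gt0 // => z.
by rewrite big_ord_recr /= IH E; ring.
Qed.

Lemma MD_weighted_powers (R : realType) (lam : int -> R) (N : nat) (p : R) :
  (forall n, 1 < lam n) -> (0 < N)%N -> weighted_powers p (MD lam N p).
Proof.
move=> lam1 N0; have lam0 n : 0 < lam n by apply: lt_trans (lam1 n).
have -> : N = N.-1.+1 by rewrite prednK.
move: N.-1 => {N0} m; rewrite /MD doubleS.
pose F k z := let i := k%:Z - m.+1%:Z in
  `|(Defs.orbit lam z (i + 1)).1 - (Defs.orbit lam z i).1| `^ p +
  `|(Defs.orbit lam z (i + 1)).2 - (Defs.orbit lam z i).2| `^ p.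
apply: (weighted_powers_sum _ _ _ F) => k; rewrite /F /=; set i := _ - _.
have [c c0 orbE] := orbit_diagonal _ lam i lam0.
(* The increments at time [i] are [(lam i - 1) * c * x] and [- (1 - (lam i)^-1) * c^-1 * y];
   [lam i > 1] makes both weights positive. *)
exists (((lam i - 1) * c) `^ p), (((1 - (lam i)^-1) * c^-1) `^ p).
have a0 : 0 < (lam i - 1) * c by rewrite mulr_gt0 // subr_gt0.
have b0 : 0 < (1 - (lam i)^-1) * c^-1.
  by rewrite mulr_gt0 ?invr_gt0 // subr_gt0 invf_lt1.
split; rewrite ?powR_gt0 // => z.
rewrite Defs.orbitS => [|n]; last by rewrite gt_eqF.
rewrite orbE /step /= -!powRM ?(ltW a0) ?(ltW b0) //.
rewrite -{1}(gtr0_norm a0) -{1}(gtr0_norm b0) -!normrM.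
congr (`|_| `^ p + _); first by ring.
by rewrite -normrN; congr (`|_| `^ p); ring.
Qed.

(** The coordinates are abstracted to [pi] and [rho], so that exchanging the two projections yields
    the stable and the unstable case from one argument. *)
Lemma weighted_powers_not_differentiable (R : realType)
    (pi rho : {linear (R * R)%type -> R}) (f : R * R -> R) (A B p : R) :
  (forall z, pi z = 0 -> rho z = 0 -> z = 0) ->
  0 < A -> 0 < B -> 0 < p < 1 ->
  (forall z, f z = A * `|pi z| `^ p + B * `|rho z| `^ p) ->
  forall L, is_line L -> transverse L [set z | pi z = 0] ->
  exists P, L `&` [set z | pi z = 0] = [set P] /\ ~ differentiable_on_line f L P.
Proof.
move=> inj A0 B0 /andP[p0 p1] fE L [a [v [v0 ->{L}]]] tr.
have lineE (g : {linear (R * R)%type -> R}) (t : R) :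
  g (a + t *: v) = g a + t * g v by rewrite linearD linearZ.
(* Otherwise [rho v] is nonzero and every [z] in the kernel of [pi] equals [(rho z / rho v) *: v],
   so this kernel is a line directed by [v], against transversality. *)
have piv : pi v != 0.
  apply/negP => /eqP piv; apply: tr; exists a, 0, v; split => //.
  have rv : rho v != 0 by apply: contra_neq v0 => /(inj _ piv).
  apply/seteqP; split => z /= => [piz|[t _ <-]]; last first.
    by rewrite add0r linearZ /= piv scaler0.
  exists (rho z / rho v) => //; rewrite add0r; apply/esym/eqP.
  rewrite -subr_eq0; apply/eqP/inj; rewrite linearB linearZ /=.
    by rewrite piz piv scaler0 subr0.
  by rewrite /GRing.scale /= divfK // subrr.
pose t0 := - pi a / pi v.
have piP : pi (a + t0 *: v) = 0 by rewrite lineE divfK // subrr.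
exists (a + t0 *: v); split.
  apply/seteqP; split => [z /= [[t _ <-]]|z /= ->]; last by split => //; exists t0.
  rewrite lineE => piz; congr (_ + _ *: _); apply: (mulIf piv).
  by rewrite divfK //; apply/eqP; rewrite -addr_eq0 addrC piz.
move/(differentiable_on_lineE _ _ _ v0).
pose y := rho (a + t0 *: v); pose w := rho v.
(* Moving in the direction [s] changes [rho] from [y] to [y + s * h * w], whose square has a
   nonnegative cross term; so [|rho|] does not decrease. *)
pose s : R := if 0 <= y * w then 1 else -1.
have s1 : `|s| = 1 by rewrite /s; case: ifP; rewrite ?normrN normr1.
have ysw : 0 <= y * (s * w).
  rewrite /s; case: (lerP 0 (y * w)) => yw; first by rewrite mul1r.
  by rewrite mulN1r mulrN oppr_ge0 ltW.
apply: (@not_derivable_of_power_growth _ _ t0 s (A * `|pi v| `^ p) p) => //.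
  by rewrite mulr_gt0 // powR_gt0 // normr_gt0.
move=> h h0.
have shiftE (g : {linear (R * R)%type -> R}) :
    g (a + (t0 + s * h) *: v) = g (a + t0 *: v) + s * h * g v.
  by rewrite !lineE; ring.
(* The [pi] term vanishes at [t0] because [p] is nonzero; the power of 0 with exponent 0 would be
   1. *)
rewrite !fE !shiftE piP add0r normr0 powR0 ?gt_eqF // mulr0 add0r.
rewrite !normrM s1 mul1r (gtr0_norm h0) powRM ?(ltW h0) // -/y -/w.
have : `|y| `^ p <= `|y + s * h * w| `^ p.
  apply: ge0_ler_powR; rewrite ?nnegrE ?(ltW p0) //.
  rewrite -ler_sqr ?nnegrE // !real_normK ?num_real //.
  have -> : (y + s * h * w) ^+ 2 = y ^+ 2 + 2 * h * (y * (s * w)) + (s * h * w) ^+ 2.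
    by ring.
  by rewrite -addrA lerDl addr_ge0 ?sqr_ge0 // mulr_ge0 // mulr_ge0 // ltW.
rewrite -(ler_pM2l B0); lra.
Qed.

Theorem mainTheorem2 (R : realType) (lam : int -> R) (N : nat) (p : R)
    (hlam : forall n : int, 1 < lam n) (hN : (1 <= N)%N) (hp : 0 < p < 1) :
  (forall L : set (R * R), is_line L -> transverse L stable_manifold ->
     exists P : R * R, L `&` stable_manifold = [set P] /\
       ~ differentiable_on_line (MD lam N p) L P) /\
  (forall L : set (R * R), is_line L -> transverse L unstable_manifold ->
     exists P : R * R, L `&` unstable_manifold = [set P] /\
       ~ differentiable_on_line (MD lam N p) L P).
Proof.
have [A [B [A0 B0 E]]] := MD_weighted_powers _ lam N p hlam hN.
split.
  apply: (weighted_powers_not_differentiable _ fst snd _ A B p) => //.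
  by case=> x y /= -> ->.
apply: (weighted_powers_not_differentiable _ snd fst _ B A p) => //.
  by case=> x y /= -> ->.
by move=> z; rewrite E addrC.
Qed.
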